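(* Let $I\subset\mathbb{R}$ be an interval and let $\gamma\colon I\to\mathbb{S}^n\subset\mathbb{R}^{n+1}$ be a smooth curve which is parametrized by arclength. Then $\gamma$ is a proper $4$-harmonic curve if it is a non-geodesic solution of \begin{align*} 0=&\gamma^{(8)}+2\gamma^{(6)}+3\gamma^{(4)}-\gamma^{(4)}|\gamma''|^2-6\gamma''|\gamma''|^2+4\gamma''-2\gamma''\langle\gamma^{(4)},\gamma''\rangle\\ &+5\frac{d^2}{ds^2}\big(\gamma'\langle\gamma^{(4)},\gamma'\rangle\big)-\frac{d^4}{ds^4}\big(|\gamma''|^2\gamma\big)-6\gamma'\frac{d}{ds}|\gamma''|^2-2\gamma'\frac{d}{ds}\langle\gamma^{(4)},\gamma''\rangle-5\frac{d}{ds}\big(\gamma''\langle\gamma^{(4)},\gamma'\rangle\big)\\ &-\gamma\big(\langle\gamma^{(8)},\gamma\rangle+2\langle\gamma^{(6)},\gamma\rangle+3|\gamma''|^2-|\gamma''|^4+6|\gamma''|^2-4+2\langle\gamma^{(4)},\gamma''\rangle\big)\\ &-\gamma\bigg(5\Big\langle\gamma,\frac{d^2}{ds^2}\big(\gamma'\langle\gamma^{(4)},\gamma'\rangle\big)\Big\rangle-\Big\langle\gamma,\frac{d^4}{ds^4}\big(|\gamma''|^2\gamma\big)\Big\rangle-5\Big\langle\gamma,\frac{d}{ds}\big(\gamma''\langle\gamma^{(4)},\gamma'\rangle\big)\Big\rangle\bigg). \end{align*}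
   Context: $\mathbb{S}^n\subset\mathbb{R}^{n+1}$ is the unit sphere with the round metric; $\langle\cdot,\cdot\rangle$ and $|\cdot|$ are the Euclidean inner product and norm of $\mathbb{R}^{n+1}$; $s$ is the parameter of $\gamma$ and $\gamma',\gamma'',\gamma''',\gamma^{(l)}$ denote derivatives with respect to $s$ of $\gamma$ regarded as an $\mathbb{R}^{n+1}$-valued map. Parametrized by arclength means $|\gamma'|=1$. Let $T=\gamma'$ and let $\nabla_T$ be covariant differentiation along $\gamma$ for the Levi-Civita connection; for a vector field $X$ along $\gamma$ tangent to $\mathbb{S}^n$, $\nabla_TX=X'+\langle X,\gamma'\rangle\gamma$. A curve $\gamma\colon I\to M$ into a Riemannian manifold $(M,g)$ is called $r$-harmonic ($r\ge 2$) if it is a critical point of $E_r(\gamma)=\frac12\int_I|\nabla_T^{r-1}T|^2\,ds$, equivalently if $$0=\tau_r(\gamma)=\nabla_T^{2r-1}T+\sum_{l=0}^{r-2}(-1)^lR^M(\nabla_T^{2r-3-l}T,\nabla_T^lT)T,$$ where $R^M$ is the curvature tensor of $M$; for $M=\mathbb{S}^n$ one has $R(X,Y)Z=\langle Y,Z\rangle X-\langle X,Z\rangle Y$. A geodesic is a curve with $\nabla_TT=0$; an $r$-harmonic curve is called proper if it is not a geodesic. A $4$-harmonic curve is the case $r=4$. *)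

(* Defs.v *)
From mathcomp Require Import all_boot all_order ssralg ssrnum interval matrix.
From mathcomp Require Import all_classical all_reals all_analysis.

Set Implicit Arguments.
Unset Strict Implicit.
Unset Printing Implicit Defensive.

Import Order.TTheory GRing.Theory Num.Theory.
Import numFieldNormedType.Exports.

Local Open Scope ring_scope.
Local Open Scope classical_set_scope.

(* The library norm on 'rV[R]_m is the sup norm, hence the Euclidean inner
   product and norm below. *)
Definition dot (R : realType) (m : nat) (u v : 'rV[R]_m) : R :=
  \sum_(i < m) u ord0 i * v ord0 i.

Notation "''[' u , v ]" := (dot u v) : ring_scope.

Definition enorm (R : realType) (m : nat) (u : 'rV[R]_m) : R :=
  Num.sqrt '[u, u].

Definition sphere (R : realType) (n : nat) : set 'rV[R]_n.+1 :=
  [set x | enorm x = 1].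
Arguments sphere : clear implicits.

(* [f] is C^oo on a neighbourhood of [A]: all iterated directional derivatives
   exist and are differentiable there. A smooth map on a set [A] that need not
   be open is, as usual, one with such an extension; the total function [f]
   stands for the extension, and at endpoints of an interval its derivatives
   are the one-sided derivatives of the restriction to the interval. *)
Definition smooth_on (R : realType) (V W : normedModType R) (A : set V)
    (f : V -> W) : Prop :=
  exists U : set V, [/\ open U, A `<=` U &
    forall (vs : seq V) (x : V), U x ->
      differentiable (foldr (fun v g => 'D_v g) f vs) x].

Section curves.
Context (R : realType) (n : nat).
Implicit Types (c X : R -> 'rV[R]_n.+1) (I : set R).

(* [nabla c X] is the covariant derivative along the curve [c] in the unit
   sphere of the vector field [X] along [c] (tangent to the sphere). *)
Definition nabla c X : R -> 'rV[R]_n.+1 :=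
  fun s => X^`() s + '[X s, c^`() s] *: c s.

Definition geodesic I c : Prop :=
  forall s, I s -> nabla c c^`() s = 0.

(* the contribution of [a, b] to E_r *)
Definition energy (r : nat) (a b : R) c : R :=
  2^-1 * \int[lebesgue_measure]_(s in `[a, b])
           enorm (iter r.-1 (nabla c) c^`() s) ^+ 2.

(* [G (t, s)] is a smooth variation, through curves I -> S^n, of the curve [c]
   defined on the interval [I], for -e < t < e, and it is supported in [a, b]. *)
Definition sphere_variation I c (a b e : R)
    (G : R * R -> 'rV[R]_n.+1) : Prop :=
  [/\ smooth_on ([set t | - e < t < e] `*` I : set (R^o * R^o)%type) G,
      (forall t s, - e < t < e -> I s -> sphere R n (G (t, s))),
      (forall s, I s -> G (0, s) = c s) &
      (forall t s, - e < t < e -> I s -> ~ `[a, b] s -> G (t, s) = c s)].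

(* Critical points of E_r, with respect to variations with compact support in
   the interior of the domain. Such a variation changes the energy density on
   its support only, so that the first variation is computed there; E_r over
   the whole domain may be infinite. *)
Definition r_harmonic (r : nat) I c : Prop :=
  forall (a b e : R) (G : R * R -> 'rV[R]_n.+1),
    a < b -> `[a, b] `<=` I° -> 0 < e -> sphere_variation I c a b e G ->
    is_derive (0 : R^o) 1
      (fun t : R^o => energy r a b (fun s => G (t, s)) : R^o) 0.

Definition proper_r_harmonic (r : nat) I c : Prop :=
  r_harmonic r I c /\ ~ geodesic I c.

End curves.

(* Main.v *)
(* The energy density of a curve g in the sphere is |W|^2, where
   W = nabla^3 g' = g^(4) + |g'|^2 g'' + 5 <g', g''> g' + mu g is orthogonal to g.
   For a variation of a unit speed curve c with field z = d/dt at t = 0, half the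
   t-derivative of the density is a sum of terms <X, z^(k)>, each of which equals
   (-1)^k <X^(k), z> up to the derivative of a function that vanishes at both ends
   of the support. What remains is <Z, z>, where Z agrees with the given equation
   up to a multiple of c, and <c, z> = 0. *)

(* The curves near c in a variation need not have unit speed. W is therefore expanded for an
   arbitrary curve in the sphere and differentiated in t before the relations of a unit speed curve
   are inserted at t = 0. There mu becomes 1 - |c''|^2, while the t-derivative of mu disappears
   because it multiplies c, to which W is orthogonal. Three exchanges carry the analysis. The
   t-derivative passes through the s-derivatives by the symmetry of mixed derivatives, and through
   the integral by a constant bound on a compact rectangle. The derivatives of z vanish at the ends
   of the support because they are limits of zeros from outside it, which is why the work takes
   place on the open interior of the interval. Integration by parts is done on integrands, so that
   only one integral of a derivative is evaluated, at the very end. *)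
Require Import Defs.
From mathcomp Require Import all_boot all_order ssralg ssrnum interval matrix.
From mathcomp Require Import all_classical all_reals all_analysis.
From mathcomp Require Import ring.

Import Order.TTheory GRing.Theory Num.Theory.
Import numFieldNormedType.Exports.

Local Open Scope ring_scope.
Local Open Scope classical_set_scope.

(** * Smooth real functions on a subset of a normed space *)

Section smooth.
Context {R : realType} {V : normedModType R}.
Implicit Types (O : set V) (f g : V -> R) (v : V).

(* Continuity and directional derivability, rather than [differentiable], make
   the class stable under local equality and cover all that is used. *)
Fixpoint Cn k O f : Prop :=
  if k is k'.+1 then
    (forall x, O x -> {for x, continuous f} /\ forall v, derivable f x v) /\
    (forall v, Cn k' O ('D_v f))
  else True.

Definition smooth O f := forall k, Cn k O f.

Lemma open_near_eq {W : Type} {O} {f g : V -> W} {x} :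
  open O -> O x -> {in O, f =1 g} -> \near x, f x = g x.
Proof.
move=> oO Ox fg; apply: filterS (open_nbhs_nbhs (conj oO Ox)) => y Oy.
by apply: fg; rewrite inE.
Qed.

Lemma eq_on_derive {W : normedModType R} {O} {f g : V -> W} v :
  open O -> {in O, f =1 g} -> {in O, 'D_v f =1 'D_v g}.
Proof.
by move=> oO fg x /set_mem Ox; exact: near_eq_derive (open_near_eq oO Ox fg).
Qed.

Lemma eq_on_Cn {O} k f g : open O -> {in O, f =1 g} -> Cn k O f -> Cn k O g.
Proof.
move=> oO; elim: k f g => [//|k IH] f g fg /= [df Df]; split; last first.
  by move=> v; apply: IH (Df v); exact: eq_on_derive.
move=> x Ox; have [cf dfx] := df x Ox; have E := open_near_eq oO Ox fg.
split; last by move=> v; exact: near_eq_derivable (dfx v).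
rewrite /prop_for /continuous_at -(fg x); last by rewrite inE.
by apply: cvg_trans cf; apply: near_eq_cvg.
Qed.

Lemma eq_on_smooth {O f g} : open O -> {in O, f =1 g} -> smooth O f -> smooth O g.
Proof. by move=> oO fg sf k; exact: eq_on_Cn (sf k). Qed.

Lemma CnW k O f : Cn k.+1 O f -> Cn k O f.
Proof.
elim: k f => [//|k IH] f [df Df]; split=> // v.
exact: (IH _ (Df v)).
Qed.

Lemma smooth_derivable {O f x} v : smooth O f -> O x -> derivable f x v.
Proof. by move=> /(_ 1%N)[+ _] => /[apply]-[]. Qed.

Lemma smooth_continuous {O f x} : smooth O f -> O x -> {for x, continuous f}.
Proof. by move=> /(_ 1%N)[+ _] => /[apply]-[]. Qed.

Lemma smooth_derive {O f} v : smooth O f -> smooth O ('D_v f).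
Proof. by move=> sf k; have [_] := sf k.+1; exact. Qed.

Lemma smooth_cst O (a : R) : smooth O (cst a).
Proof.
move=> k; elim: k a => [//|k IH] a; split=> [x _|v].
  by split=> [|v]; [exact: cst_continuous | exact: derivable_cst].
have -> : 'D_v (cst a : V -> R) = cst 0.
  by apply/funext => x; rewrite derive_cst.
exact: IH.
Qed.

Lemma CnD {O f g} k : open O -> Cn k O f -> Cn k O g ->
  Cn k O (fun x => f x + g x).
Proof.
move=> oO; elim: k f g => [//|k IH] f g [df Df] [dg Dg]; split=> [x Ox|v].
  have [cf vf] := df x Ox; have [cg vg] := dg x Ox.
  split=> [|v]; first exact: (continuousD cf cg).
  exact: derivableD (vf v) (vg v).
apply: eq_on_Cn (IH _ _ (Df v) (Dg v)) => //.
move=> x /set_mem Ox.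
have [[_ vf] [_ vg]] := (df x Ox, dg x Ox).
exact: (esym (deriveD (vf v) (vg v))).
Qed.

Lemma CnM {O f g} k : open O -> Cn k O f -> Cn k O g ->
  Cn k O (fun x => f x * g x).
Proof.
move=> oO; elim: k f g => [//|k IH] f g sf sg.
have [df Df] := sf; have [dg Dg] := sg; split=> [x Ox|v].
  have [cf vf] := df x Ox; have [cg vg] := dg x Ox.
  split=> [|v]; first exact: (continuousM cf cg).
  exact: derivableM (vf v) (vg v).
(* In the product rule one factor of each product is left undifferentiated, so its order is lowered
   from k+1 to k by [CnW]. *)
have := CnD k oO (IH _ _ (CnW _ _ _ sf) (Dg v)) (IH _ _ (CnW _ _ _ sg) (Df v)).
apply: eq_on_Cn => // x /set_mem Ox.
have [[_ vf] [_ vg]] := (df x Ox, dg x Ox).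
exact: (esym (deriveM (vf v) (vg v))).
Qed.

Lemma smoothD {O f g} : open O -> smooth O f -> smooth O g ->
  smooth O (fun x => f x + g x).
Proof. by move=> oO sf sg k; exact: CnD. Qed.

Lemma smoothM {O f g} : open O -> smooth O f -> smooth O g ->
  smooth O (fun x => f x * g x).
Proof. by move=> oO sf sg k; exact: CnM. Qed.

Lemma smooth_sum {O m} {F : 'I_m -> V -> R} : open O ->
  (forall i, smooth O (F i)) -> smooth O (fun x => \sum_(i < m) F i x).
Proof.
move=> oO sF; elim: m F sF => [|m IH] F sF.
  apply: eq_on_smooth (smooth_cst O 0) => // x _.
  by rewrite big_ord0.
apply: eq_on_smooth (smoothD oO (IH _ (fun i => sF (widen_ord (leqnSn m) i)))
  (sF ord_max)) => // x _.
by rewrite big_ord_recr.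
Qed.

End smooth.

(** * Vector-valued smooth maps and the Euclidean inner product *)

Section vsmooth.
Context {R : realType} {V : normedModType R} {n : nat}.
Implicit Types (O : set V) (f g : V -> R) (X Y : V -> 'rV[R]_n) (v : V).

(** Asked coordinate by coordinate, so that vector calculus reduces to the scalar sum and product
    rules; the inner product, a sum of products of coordinates, is covered too. *)
Definition vsmooth O X := forall i, smooth O (fun x => X x ord0 i).

Lemma vsmooth_derivable {O X x} v : vsmooth O X -> O x -> derivable X x v.
Proof.
move=> sX Ox; apply/derivable_mxP => i j; rewrite ord1.
exact: smooth_derivable.
Qed.

Lemma vsmooth_derive_coord {O X x} v i : vsmooth O X -> O x ->
  'D_v X x ord0 i = 'D_v (fun y => X y ord0 i) x.
Proof.
by move=> sX Ox; rewrite (derive_mx (vsmooth_derivable v sX Ox)) mxE.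
Qed.

Lemma vsmooth_derive {O X} v : open O -> vsmooth O X -> vsmooth O ('D_v X).
Proof.
move=> oO sX i; apply: eq_on_smooth (smooth_derive v (sX i)) => // x /set_mem Ox.
by rewrite (vsmooth_derive_coord _ _ sX Ox).
Qed.

Lemma eq_on_vsmooth {O X Y} : open O -> {in O, X =1 Y} ->
  vsmooth O X -> vsmooth O Y.
Proof.
move=> oO XY sX i; apply: eq_on_smooth (sX i) => // x Ox.
by rewrite XY.
Qed.

Lemma vsmoothD {O X Y} : open O -> vsmooth O X -> vsmooth O Y ->
  vsmooth O (fun x => X x + Y x).
Proof.
move=> oO sX sY i; apply: eq_on_smooth (smoothD oO (sX i) (sY i)) => // x _.
by rewrite mxE.
Qed.

Lemma vsmoothZ {O f X} : open O -> smooth O f -> vsmooth O X ->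
  vsmooth O (fun x => f x *: X x).
Proof.
move=> oO sf sX i; apply: eq_on_smooth (smoothM oO sf (sX i)) => // x _.
by rewrite mxE.
Qed.

Lemma smooth_dot {O X Y} : open O -> vsmooth O X -> vsmooth O Y ->
  smooth O (fun x => '[X x, Y x]).
Proof.
by move=> oO sX sY; apply: smooth_sum => // i; exact: smoothM.
Qed.

Lemma derive_vD {O X Y x} v : vsmooth O X -> vsmooth O Y -> O x ->
  'D_v (fun y => X y + Y y) x = 'D_v X x + 'D_v Y x.
Proof.
move=> sX sY Ox.
exact: (deriveD (vsmooth_derivable v sX Ox) (vsmooth_derivable v sY Ox)).
Qed.

Lemma derive_vZ {O f X x} v : open O -> smooth O f -> vsmooth O X -> O x ->
  'D_v (fun y => f y *: X y) x = 'D_v f x *: X x + f x *: 'D_v X x.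
Proof.
move=> oO sf sX Ox; apply/rowP => i.
rewrite (vsmooth_derive_coord _ _ (vsmoothZ oO sf sX) Ox) !mxE.
rewrite (vsmooth_derive_coord _ _ sX Ox) -[RHS]addrC [X in _ + X]mulrC.
rewrite -[RHS](deriveM (smooth_derivable v sf Ox) (smooth_derivable v (sX i) Ox)).
by congr (derive _ x v); apply/funext => y; rewrite mxE.
Qed.

Lemma derive_sum_fun {O m} {F : 'I_m -> V -> R} {x} v : open O ->
  (forall i, smooth O (F i)) -> O x ->
  'D_v (fun y => \sum_(i < m) F i y) x = \sum_(i < m) 'D_v (F i) x.
Proof.
move=> oO sF Ox; rewrite -derive_sum; last by move=> i; exact: smooth_derivable.
by congr (derive _ x v); apply/funext => y; rewrite fct_sumE.
Qed.

Lemma derive_dot {O X Y x} v : open O -> vsmooth O X -> vsmooth O Y -> O x ->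
  'D_v (fun y => '[X y, Y y]) x = '['D_v X x, Y x] + '[X x, 'D_v Y x].
Proof.
move=> oO sX sY Ox; rewrite /dot.
rewrite (derive_sum_fun v oO _ Ox); last by move=> i; exact: smoothM.
rewrite -big_split; apply: eq_bigr => i _ /=.
rewrite !(vsmooth_derive_coord _ _ _ Ox)//.
rewrite [LHS](deriveM (smooth_derivable v (sX i) Ox) (smooth_derivable v (sY i) Ox)).
by rewrite addrC; congr (_ + _); exact: mulrC.
Qed.

Lemma dotC (u w : 'rV[R]_n) : '[u, w] = '[w, u].
Proof. by apply: eq_bigr => i _; rewrite mulrC. Qed.

Lemma dotDl (u1 u2 w : 'rV[R]_n) : '[u1 + u2, w] = '[u1, w] + '[u2, w].
Proof. by rewrite -big_split; apply: eq_bigr => i _; rewrite mxE mulrDl. Qed.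

Lemma dotZl a (u w : 'rV[R]_n) : '[a *: u, w] = a * '[u, w].
Proof. by rewrite /dot mulr_sumr; apply: eq_bigr => i _; rewrite mxE mulrA. Qed.

Lemma dotDr (u w1 w2 : 'rV[R]_n) : '[u, w1 + w2] = '[u, w1] + '[u, w2].
Proof. by rewrite dotC dotDl !(dotC _ u). Qed.

Lemma dotZr a (u w : 'rV[R]_n) : '[u, a *: w] = a * '[u, w].
Proof. by rewrite dotC dotZl dotC. Qed.

Lemma enorm_sqr (u : 'rV[R]_n) : enorm u ^+ 2 = '[u, u].
Proof.
by rewrite sqr_sqrtr//; apply: sumr_ge0 => i _; rewrite -expr2 sqr_ge0.
Qed.

End vsmooth.

Lemma smooth_sub {R : realType} {V : normedModType R} {O U : set V} {f : V -> R} :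
  O `<=` U -> smooth U f -> smooth O f.
Proof.
move=> OU sf k; have {sf} := sf k; elim: k f => [//|k IH] f [df Df].
by split=> [x /OU|v]; [exact: df | exact: IH (Df v)].
Qed.

Lemma vsmooth_sub {R : realType} {V : normedModType R} {n : nat} {O U : set V}
  {X : V -> 'rV[R]_n} : O `<=` U -> vsmooth U X -> vsmooth O X.
Proof. by move=> OU sX i; exact: smooth_sub (sX i). Qed.

(** The passage from the condition in [smooth_on], which variations satisfy, to the coordinatewise
    class of the proof. *)
Lemma differentiable_vsmooth {R : realType} {V : normedModType R} {n : nat}
    (U : set V) (X : V -> 'rV[R]_n) : open U ->
  (forall (vs : seq V) x, U x -> differentiable (foldr (fun v g => 'D_v g) X vs) x) ->
  vsmooth U X.
Proof.
move=> oU dX i k; elim: k X dX => [//|k IH] X dX; split=> [x Ux|v].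
  have d := dX [::] x Ux; split=> [|v].
    apply: (@continuous_comp _ _ _ X (fun M : 'rV[R]_n => M ord0 i)).
      exact: differentiable_continuous.
    exact: coord_continuous.
  by have /derivable_mxP := @diff_derivable _ _ _ _ _ v d; exact.
apply: (@eq_on_Cn _ _ _ _ (fun x => 'D_v X x ord0 i)) => //.
  move=> x /set_mem Ux; rewrite derive_mx ?mxE//.
  exact: diff_derivable (dX [::] x Ux).
(* Appending [v] to the list makes ['D_v] act on [X] first, so the iterated derivatives of ['D_v X]
   are among those of [X]. *)
by apply: IH => vs x Ux; have := dX (rcons vs v) x Ux; rewrite foldr_rcons.
Qed.

(** * Restriction to lines *)

Section line.
Context {R : realType} {V W : normedModType R}.

(** The two quotients agree as functions of k, so existence and value of the derivative transfer
    together and no chain rule enters. *)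
Lemma line_quotient (f : V -> W) (v p : V) (h : R) :
  (fun k : R => k^-1 *: (((fun r : R => f (r *: v + p)) \o shift h) (k *: 1) -
     f (h *: v + p))) =
  (fun k : R => k^-1 *: ((f \o shift (h *: v + p)) (k *: v) - f (h *: v + p))).
Proof.
by apply/funext => k /=; rewrite [k *: 1]mulr1 scalerDl addrA.
Qed.

Lemma line_is_derive (f : V -> W) (v p : V) (h : R) : derivable f (h *: v + p) v ->
  is_derive h (1 : R^o) (fun r : R => f (r *: v + p)) ('D_v f (h *: v + p)).
Proof.
move=> d; apply: DeriveDef; first by rewrite /derivable line_quotient.
by rewrite /derive line_quotient.
Qed.

End line.

(** * Symmetry of mixed directional derivatives *)

Section schwarz.
Context {R : realType} {V : normedModType R}.
Implicit Types (O : set V) (f : V -> R) (v w x : V).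

(** The mean value theorem twice: in direction [v] for the difference of [f] over the step [h *: w],
    then in direction [w] for ['D_v f]. *)
Lemma second_difference O f v w x (h : R) : 0 < h -> smooth O f ->
  (forall r r', 0 <= r <= h -> 0 <= r' <= h -> O (r *: v + (r' *: w + x))) ->
  exists r r', [/\ 0 <= r <= h, 0 <= r' <= h &
    f (h *: v + (h *: w + x)) - f (h *: v + x) - (f (h *: w + x) - f x) =
    h * h * 'D_w ('D_v f) (r *: v + (r' *: w + x))].
Proof.
move=> h0 sf Oh.
have O0 r : 0 <= r <= h -> O (r *: v + x).
  by move=> rh; have := Oh r 0 rh; rewrite scale0r add0r; apply; rewrite lexx ltW.
have hh : 0 <= h <= h by rewrite lexx ltW.
pose phi r := f (r *: v + (h *: w + x)) - f (r *: v + x).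
have dphi r : 0 <= r <= h -> is_derive r (1 : R^o) (phi : R^o -> R^o)
    ('D_v f (r *: v + (h *: w + x)) - 'D_v f (r *: v + x)).
  move=> rh; apply: is_deriveB; apply: line_is_derive.
    exact: smooth_derivable sf (Oh _ _ rh hh).
  exact: smooth_derivable sf (O0 _ rh).
have cphi : {within `[0, h], continuous phi}.
  apply: derivable_within_continuous => r; rewrite in_itv /= => /dphi.
  by case.
have [r r0h] := MVT h0 (fun r rh => dphi r (subset_itv_oo_cc rh)) cphi.
rewrite /phi !scale0r !add0r subr0 => ->.
have {}r0h : 0 <= r <= h by move: r0h; rewrite in_itv /= => /andP[/ltW-> /ltW->].
pose psi r' := 'D_v f (r' *: w + (r *: v + x)).
have dpsi r' : 0 <= r' <= h -> is_derive r' (1 : R^o) (psi : R^o -> R^o)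
    ('D_w ('D_v f) (r' *: w + (r *: v + x))).
  move=> rh; apply: line_is_derive.
  by apply: smooth_derivable (smooth_derive v sf) _; rewrite addrCA; exact: Oh.
have cpsi : {within `[0, h], continuous psi}.
  apply: derivable_within_continuous => r'; rewrite in_itv /= => /dpsi.
  by case.
have [r' r'0h] := MVT h0 (fun r rh => dpsi r (subset_itv_oo_cc rh)) cpsi.
rewrite /psi scale0r add0r subr0 (addrCA (h *: w)) => ->.
exists r, r'; split=> //.
  by move: r'0h; rewrite in_itv /= => /andP[/ltW-> /ltW->].
by rewrite addrCA -mulrA mulrC.
Qed.

Lemma nbhs_parallelogram {x} v w {P : set V} : nbhs x P ->
  exists2 d : R, 0 < d & forall r r', `|r| < d -> `|r'| < d ->
    P (r *: v + (r' *: w + x)).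
Proof.
move=> N.
have C : (fun p : R * R => p.1 *: v + (p.2 *: w + x)) p @[p --> (0, 0)] --> x.
  rewrite -[X in _ --> X](_ : 0 *: v + (0 *: w + x) = x); last first.
    by rewrite !scale0r !add0r.
  apply: cvgD; first by apply: cvgZr_tmp; exact: cvg_fst.
  by apply: cvgD; [by apply: cvgZr_tmp; exact: cvg_snd | exact: cvg_cst].
have /nbhs_ballP[d /= d0 Bd] := C _ N.
exists d => // r r' rd r'd; apply: (Bd (r, r')).
by split=> /=; rewrite -ball_normE /= sub0r normrN.
Qed.

(** The second difference over a parallelogram is symmetric in [v] and [w]. Evaluated in both
    orders, it gives the two mixed derivatives a common value at two points near [x], and their
    continuity brings the values at [x] within any [e] of each other. *)
Lemma schwarz O f v w x : open O -> smooth O f -> O x ->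
  'D_v ('D_w f) x = 'D_w ('D_v f) x.
Proof.
move=> oO sf Ox; apply/eqP; rewrite -subr_eq0 -normr_eq0 eq_le normr_ge0 andbT.
apply/ler_addgt0Pr => e e0; rewrite add0r.
pose A := 'D_w ('D_v f); pose B := 'D_v ('D_w f); rewrite -/A -/B.
have cA : {for x, continuous A}.
  exact: smooth_continuous (smooth_derive w (smooth_derive v sf)) Ox.
have cB : {for x, continuous B}.
  exact: smooth_continuous (smooth_derive v (smooth_derive w sf)) Ox.
have tri (a b z : R) : `|a - z| < e / 2 -> `|b - z| < e / 2 -> `|b - a| <= e.
  move=> az bz; rewrite -(subrKA z) [leRHS]splitr (le_trans (ler_normD _ _))//.
  by rewrite lerD ?ltW// distrC.
have e20 : 0 < e / 2 by rewrite divr_gt0.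
have N : \forall y \near x, [/\ O y, `|A x - A y| < e / 2 & `|B x - B y| < e / 2].
  have NA : \forall y \near x, `|A x - A y| < e / 2 by move/cvgrPdist_lt : cA; apply.
  have NB : \forall y \near x, `|B x - B y| < e / 2 by move/cvgrPdist_lt : cB; apply.
  by apply: filterS3 (open_nbhs_nbhs (conj oO Ox)) NA NB => y.
have [d d0 Bd] := nbhs_parallelogram v w N.
(* Halving keeps the closed range [0, h] strictly below [d]. *)
pose h := d / 2.
have h0 : 0 < h by rewrite divr_gt0.
have hd r : 0 <= r <= h -> `|r| < d.
  move=> /andP[r0 rh]; rewrite ger0_norm// (le_lt_trans rh)//.
  by rewrite ltr_pdivrMr// ltr_pMr// ltr1n.
have [|r [r' [rh r'h E]]] := @second_difference O f v w x h h0 sf.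
  by move=> r r' /hd rd /hd r'd; have [] := Bd _ _ rd r'd.
have [|q [q' [qh q'h F]]] := @second_difference O f w v x h h0 sf.
  by move=> q q' /hd qd /hd q'd; rewrite addrCA; have [] := Bd _ _ q'd qd.
have {E F} BA : B (q' *: v + (q *: w + x)) = A (r *: v + (r' *: w + x)).
  rewrite (addrCA (q' *: v)) -/B in F *; rewrite -/A in E.
  apply: (mulfI (lt0r_neq0 (mulr_gt0 h0 h0))).
  rewrite -[RHS]E -[LHS]F (addrCA (h *: w)).
  by ring.
have [_ _ Bq] := Bd _ _ (hd _ q'h) (hd _ qh).
have [_ Ar _] := Bd _ _ (hd _ rh) (hd _ r'h).
by rewrite BA in Bq; exact: (tri (A x) (B x) _ Ar Bq).
Qed.

End schwarz.

(** * Slices of functions of two real variables *)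

Section slices.
Context {R : realType}.
Local Notation V := (R^o * R^o)%type.
Local Notation e1 := ((1, 0) : V).
Local Notation e2 := ((0, 1) : V).
Implicit Types (O : set V) (J : set R).

(** As on lines, the quotients coincide. The direction [v] is arbitrary because [smooth] on the
    slice quantifies over all directions of [R^o]. *)
Lemma second_slice_quotient {W : normedModType R} (f : V -> W) t s (v : R^o) :
  (fun k : R => k^-1 *: (((fun u : R^o => f (t, u)) \o shift s) (k *: v) - f (t, s))) =
  (fun k : R => k^-1 *: ((f \o shift (t, s)) (k *: ((0, v) : V)) - f (t, s))).
Proof.
apply/funext => k /=; congr (_ *: (f _ - _)).
by apply: injective_projections => //=; rewrite ?scaler0 ?add0r.
Qed.

Lemma first_slice_quotient {W : normedModType R} (f : V -> W) t s :
  (fun k : R => k^-1 *: (((fun u : R^o => f (u, s)) \o shift t) (k *: 1) - f (t, s))) =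
  (fun k : R => k^-1 *: ((f \o shift (t, s)) (k *: e1) - f (t, s))).
Proof.
apply/funext => k /=; congr (_ *: (f _ - _)).
by apply: injective_projections => //=; rewrite ?scaler0 ?add0r.
Qed.

Lemma derive1_second_slice {W : normedModType R} (f : V -> W) t s :
  (fun u : R => f (t, u))^`() s = 'D_e2 f (t, s).
Proof. by rewrite derive1E /derive second_slice_quotient. Qed.

Lemma derive1_first_slice {W : normedModType R} (f : V -> W) t s :
  (fun u : R => f (u, s))^`() t = 'D_e1 f (t, s).
Proof. by rewrite derive1E /derive first_slice_quotient. Qed.

Lemma derivable_first_slice {W : normedModType R} (f : V -> W) t s :
  derivable f (t, s) e1 -> derivable (fun u : R^o => f (u, s)) t 1.
Proof. by rewrite /derivable first_slice_quotient. Qed.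

Lemma derive1n_second_slice {W : normedModType R} k (f : V -> W) t :
  (fun u : R => f (t, u))^`(k) = (fun u => iter k (fun g => 'D_e2 g) f (t, u)).
Proof.
elim: k => [//|k IH]; rewrite derive1nS IH; apply/funext => s.
by rewrite derive1_second_slice.
Qed.

Lemma smooth_second_slice O J t (f : V -> R) :
  (forall s, J s -> O (t, s)) -> smooth O f ->
  smooth J (fun s : R^o => f (t, s)).
Proof.
move=> JO sf k; elim: k f sf => [//|k IH] f sf; split=> [s /JO Os|v].
  split=> [|v].
    have cf : {for ((t, s) : V), continuous f} := smooth_continuous sf Os.
    apply: continuous_comp cf.
    exact: (@cvg_pair R^o R^o R^o (nbhs s) (nbhs t) (nbhs s) _ _ _
      (fun=> t) id (cvg_cst t) cvg_id).
  by rewrite /derivable second_slice_quotient; exact: smooth_derivable sf Os.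
have -> : 'D_v (fun s : R^o => f (t, s)) = fun s => 'D_((0, v) : V) f (t, s).
  by apply/funext => s; rewrite /derive second_slice_quotient.
exact: IH (smooth_derive _ sf).
Qed.

Lemma vsmooth_second_slice {n} O J t (X : V -> 'rV[R]_n) :
  (forall s, J s -> O (t, s)) -> vsmooth O X ->
  vsmooth J (fun s : R^o => X (t, s)).
Proof. by move=> JO sX i; exact: (smooth_second_slice _ _ _ _ JO (sX i)). Qed.

End slices.

(** * Integrals over a compact interval *)

Section integrals.
Context {R : realType}.
Local Notation V := (R^o * R^o)%type.
Local Notation e1 := ((1, 0) : V).
Local Notation mu := (@lebesgue_measure R).

Lemma smooth_integrable (J : set R) (a b : R) (f : R^o -> R) :
  `[a, b] `<=` J -> smooth J f -> mu.-integrable `[a, b] (EFin \o f).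
Proof.
move=> abJ sf; apply: continuous_compact_integrable; first exact: segment_compact.
apply: continuous_in_subspaceT => s /set_mem /abJ Js.
exact: (smooth_continuous sf Js).
Qed.

Lemma Rintegral_derive1_eq0 (J : set R) (a b : R) (B : R^o -> R) : a < b ->
  `[a, b] `<=` J -> smooth J B -> B a = 0 -> B b = 0 ->
  \int[mu]_(s in `[a, b]) B^`() s = 0.
Proof.
move=> ab abJ sB Ba Bb.
have D s : `[a, b] s -> derivable B s 1 by move=> /abJ; exact: smooth_derivable.
have C s : `[a, b] s -> {for s, continuous B}.
  by move=> /abJ Js; exact: (smooth_continuous sB Js).
rewrite /Rintegral (@continuous_FTC2 R _ B a b ab) ?Ba ?Bb ?subrr//.
- by rewrite -EFinB subrr.
- apply: continuous_in_subspaceT => s /set_mem /abJ Js.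
  have -> : B^`() = 'D_(1 : R^o) B by apply/funext => x; rewrite derive1E.
  exact: (smooth_continuous (smooth_derive (1 : R^o) sB) Js).
- split=> [s sab||].
  + exact/D/subset_itv_oo_cc.
  + by apply: cvg_at_right_filter; apply: C; rewrite /= in_itv /= lexx ltW.
  + by apply: cvg_at_left_filter; apply: C; rewrite /= in_itv /= lexx ltW.
Qed.

(** Dominated differentiation under the integral sign. The bound is the maximum of the absolute
    t-derivative on the compact rectangle [-e/2, e/2] x [a, b], which lies in the domain of
    smoothness. *)
Lemma is_derive_Rintegral (J : set R) (a b e : R) (f : V -> R) : 0 < e -> a < b ->
  `[a, b] `<=` J ->
  smooth ([set t : R^o | - e < t < e] `*` J : set V) f ->
  is_derive (0 : R^o) 1
    (fun t : R^o => \int[mu]_(s in `[a, b]) f (t, s) : R^o)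
    (\int[mu]_(s in `[a, b]) 'D_e1 f (0, s)).
Proof.
move=> e0 ab abJ sf.
have he : e / 2 < e by rewrite ltr_pdivrMr// ltr_pMr// ltr1n.
have he0 : 0 < e / 2 by rewrite divr_gt0.
have OK t s : `[- (e / 2), e / 2] t -> `[a, b] s ->
    ([set t : R^o | - e < t < e] `*` J : set V) (t, s).
  rewrite /= in_itv /= => /andP[et te] sab; split; last exact: abJ.
  by rewrite /= (lt_le_trans _ et) ?ltrN2// (le_lt_trans te he).
have K : compact (`[- (e / 2), e / 2] `*` `[a, b] : set V).
  by apply: compact_setX; exact: segment_compact.
have K0 : (`[- (e / 2), e / 2] `*` `[a, b] : set V) !=set0.
  exists (0, a); split=> /=; rewrite in_itv /= ?lexx ?(ltW ab)//.
  by rewrite oppr_le0 ltW.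
have [|p _ pmax] := @compact_EVT_max _ R (fun x => `|'D_e1 f x|) _ K0 K.
  apply: continuous_in_subspaceT => -[t s] /set_mem[/= tt ss].
  have c := smooth_continuous (smooth_derive e1 sf) (OK t s tt ss).
  by apply: (continuous_comp c); exact: norm_continuous.
pose M : R := `|'D_e1 f p|.
have I0 : `](- (e / 2)), (e / 2)[ (0 : R).
  by rewrite /= in_itv /= oppr_cp0 he0.
have der t s : `](- (e / 2)), (e / 2)[ t -> `[a, b] s ->
    derivable (fun u : R => f (u, s)) t 1.
  move=> /subset_itv_oo_cc tt ss; apply: derivable_first_slice.
  exact: smooth_derivable sf (OK _ _ tt ss).
have int t : `](- (e / 2)), (e / 2)[ t ->
    mu.-integrable `[a, b] (EFin \o (fun s => f (t, s))).
  move=> tt; apply: (smooth_integrable `[a, b]) => //.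
  by apply: smooth_second_slice sf => s; apply: OK; exact: subset_itv_oo_cc.
have intM : mu.-integrable `[a, b] (EFin \o cst M).
  apply: continuous_compact_integrable; first exact: segment_compact.
  by apply: continuous_subspaceT; exact: cst_continuous.
have bnd t s : `](- (e / 2)), (e / 2)[ t -> `[a, b] s ->
    `|partial1of2 (fun u s => f (u, s)) t s| <= M.
  move=> /subset_itv_oo_cc tt ss.
  by rewrite /partial1of2 derive1_first_slice pmax// inE.
apply: DeriveDef.
  exact: (@derivable_under_integral R _ _ mu (fun u s => f (u, s)) _ (measurable_itv _) _ _ _ I0
    int der (cst M) (fun=> normr_ge0 _) intM bnd).
rewrite -derive1E.
rewrite (@differentiation_under_integral R _ _ mu (fun u s => f (u, s)) _ (measurable_itv _) _ _ _ I0
    int der (cst M) (fun=> normr_ge0 _) intM bnd).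
by apply: eq_Rintegral => s _; rewrite /partial1of2 derive1_first_slice.
Qed.

End integrals.

(** * Derivatives along curves and integration by parts *)

Section curves.
Context {R : realType} {n : nat}.
Implicit Types (J : set R^o) (f g : R^o -> R) (X Y : R^o -> 'rV[R]_n).

Lemma derive1_funE {W : normedModType R} (X : R^o -> W) :
  X^`() = 'D_(1 : R^o) X.
Proof. by apply/funext => x; rewrite derive1E. Qed.

Lemma eq_on_derive1 {W : normedModType R} {J} {X Y : R^o -> W} : open J ->
  {in J, X =1 Y} -> {in J, X^`() =1 Y^`()}.
Proof.
move=> oJ XY; rewrite !derive1_funE.
exact: (@eq_on_derive R R^o W J _ _ (1 : R^o) oJ XY).
Qed.

Lemma eq_on_derive1n {W : normedModType R} {J} {X Y : R^o -> W} k : open J ->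
  {in J, X =1 Y} -> {in J, X^`(k) =1 Y^`(k)}.
Proof.
move=> oJ XY; elim: k => [//|k IH].
by rewrite !derive1nS; exact: eq_on_derive1.
Qed.

Lemma smooth_derive1 {J f} : smooth J f -> smooth J f^`().
Proof. by move=> sf; rewrite derive1_funE; exact: smooth_derive. Qed.

Lemma vsmooth_derive1 {J X} : open J -> vsmooth J X -> vsmooth J X^`().
Proof. by move=> oJ sX; rewrite derive1_funE; exact: vsmooth_derive. Qed.

Lemma vsmooth_derive1n {J X} k : open J -> vsmooth J X -> vsmooth J X^`(k).
Proof.
move=> oJ sX; elim: k => [//|k IH]; rewrite derive1nS.
exact: vsmooth_derive1.
Qed.

Lemma derive1_D {J f g s} : smooth J f -> smooth J g -> J s ->
  (fun u => f u + g u)^`() s = f^`() s + g^`() s.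
Proof.
move=> sf sg Js; rewrite !derive1_funE.
exact: (deriveD (smooth_derivable (1 : R^o) sf Js) (smooth_derivable (1 : R^o) sg Js)).
Qed.

Lemma derive1_vD {J X Y s} : vsmooth J X -> vsmooth J Y -> J s ->
  (fun u => X u + Y u)^`() s = X^`() s + Y^`() s.
Proof. by move=> sX sY Js; rewrite !derive1_funE; exact: derive_vD sX sY Js. Qed.

Lemma derive1_vZ {J f X s} : open J -> smooth J f -> vsmooth J X -> J s ->
  (fun u => f u *: X u)^`() s = f^`() s *: X s + f s *: X^`() s.
Proof.
by move=> oJ sf sX Js; rewrite !derive1_funE; exact: derive_vZ oJ sf sX Js.
Qed.

Lemma derive1_dot {J X Y s} : open J -> vsmooth J X -> vsmooth J Y -> J s ->
  (fun u => '[X u, Y u])^`() s = '[X^`() s, Y s] + '[X s, Y^`() s].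
Proof.
by move=> oJ sX sY Js; rewrite !derive1_funE; exact: derive_dot oJ sX sY Js.
Qed.

Lemma derive1n_vD {J X Y} k : open J -> vsmooth J X -> vsmooth J Y ->
  {in J, (fun u => X u + Y u)^`(k) =1 (fun u => X^`(k) u + Y^`(k) u)}.
Proof.
move=> oJ sX sY; elim: k => [//|k IH] s sJ; rewrite !derive1nS.
rewrite (eq_on_derive1 oJ IH _ sJ).
apply: derive1_vD (vsmooth_derive1n k oJ sX) (vsmooth_derive1n k oJ sY) _.
by move/set_mem: sJ.
Qed.

(** Off [a, b] the field is zero on an open set, hence so are its derivatives. Since [J] is open
    around [a, b], the ends [a] and [b] are limits of such points from the left and from the right,
    and continuity gives 0 there. *)
Lemma derive1n_vanish {a b : R} {J X} k : open J -> a < b -> `[a, b] `<=` J ->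
  vsmooth J X -> (forall s, J s -> ~ `[a, b] s -> X s = 0) ->
  X^`(k) a = 0 /\ X^`(k) b = 0.
Proof.
move=> oJ ab abJ sX X0.
pose O := J `&` ~` `[a, b].
have oO : open O.
  by apply: openI => //; apply: closed_openC; exact: interval_closed.
have XO : {in O, X =1 cst 0} by move=> s /set_mem[Js abs]; exact: X0.
have D0 : (cst 0 : R^o -> 'rV[R]_n)^`(k) = cst 0.
  elim: k => [//|k IH]; rewrite derive1nS IH.
  by apply/funext => s; rewrite derive1_cst.
have XkO s : J s -> ~ `[a, b] s -> X^`(k) s = 0.
  move=> Js abs.
  by rewrite (eq_on_derive1n k oO XO) ?D0// inE.
have Ja : J a by apply: abJ; rewrite /= in_itv /= lexx ltW.
have Jb : J b by apply: abJ; rewrite /= in_itv /= lexx ltW.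
have nJ x : J x -> \forall y \near x, J y.
  by move=> Jx; exact: open_nbhs_nbhs (conj oJ Jx).
have c x : J x -> forall i, X^`(k) u ord0 i @[u --> x] --> X^`(k) x ord0 i.
  by move=> Jx i; exact: (smooth_continuous (vsmooth_derive1n k oJ sX i) Jx).
split; apply/rowP => i; rewrite [RHS]mxE.
- have L : X^`(k) u ord0 i @[u --> a^'-] --> X^`(k) a ord0 i.
    by apply: cvg_at_left_filter; exact: c Ja i.
  suff L0 : X^`(k) u ord0 i @[u --> a^'-] --> (0 : R) by exact: (cvg_unique _ L L0).
  apply: cvg_near_cst; near=> s; rewrite XkO ?mxE//.
    by near: s; rewrite near_withinE; apply: filterS (nJ _ Ja).
  by rewrite /= in_itv /= => /andP[+ _]; apply/negP; rewrite -ltNge; near: s;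
    exact: nbhs_left_lt.
- have L : X^`(k) u ord0 i @[u --> b^'+] --> X^`(k) b ord0 i.
    by apply: cvg_at_right_filter; exact: c Jb i.
  suff L0 : X^`(k) u ord0 i @[u --> b^'+] --> (0 : R) by exact: (cvg_unique _ L L0).
  apply: cvg_near_cst; near=> s; rewrite XkO ?mxE//.
    by near: s; rewrite near_withinE; apply: filterS (nJ _ Jb).
  by rewrite /= in_itv /= => /andP[_]; apply/negP; rewrite -ltNge; near: s;
    exact: nbhs_right_gt.
Unshelve. all: end_near. Qed.

(** The integrands that count as zero: by the fundamental theorem of calculus their integral over
    [a, b] vanishes. They are closed under linear combinations, so integration by parts becomes a
    pointwise computation modulo them. *)
Definition exact_on J (a b : R) f :=
  exists B, [/\ smooth J B, B a = 0, B b = 0 & {in J, f =1 B^`()}].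

Lemma eq_on_exact {J a b f g} : {in J, f =1 g} ->
  exact_on J a b f -> exact_on J a b g.
Proof.
move=> fg [B [sB Ba Bb fB]]; exists B; split=> // s Js.
by rewrite -fg// fB.
Qed.

Lemma exactD {J a b f g} : open J -> exact_on J a b f -> exact_on J a b g ->
  exact_on J a b (fun s => f s + g s).
Proof.
move=> oJ [B [sB Ba Bb fB]] [C [sC Ca Cb gC]].
exists (fun s => B s + C s); split; rewrite ?Ba ?Bb ?Ca ?Cb ?addr0//.
  exact: smoothD.
by move=> s Js; rewrite (derive1_D sB sC) ?fB ?gC//; move/set_mem: Js.
Qed.

Lemma exactZ {J a b f} (k : R) : open J -> exact_on J a b f ->
  exact_on J a b (fun s => k * f s).
Proof.
move=> oJ [B [sB Ba Bb fB]].
exists (fun s => k * B s); split; rewrite ?Ba ?Bb ?mulr0//.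
  exact: smoothM oJ (smooth_cst J k) sB.
move=> s Js; rewrite derive1_funE.
have -> : (fun u => k * B u) = k \*: B by [].
rewrite deriveZ; last by apply: smooth_derivable sB _; move/set_mem: Js.
by rewrite fB// derive1_funE.
Qed.

(** Induction on [k], one derivative at a time; the primitive of each step is <X, Y^(k)>, zero at
    both ends because every derivative of [Y] is. *)
Lemma exact_ibp {J a b} k X Y : open J -> vsmooth J X -> vsmooth J Y ->
  (forall l, Y^`(l) a = 0 /\ Y^`(l) b = 0) ->
  exact_on J a b
    (fun s => '[X s, Y^`(k) s] - (-1) ^+ k * '[X^`(k) s, Y s]).
Proof.
move=> oJ sX sY Y0; elim: k X sX => [|k IH] X sX.
  exists (cst 0); split=> // [|s _]; first exact: smooth_cst.
  by rewrite derive1_cst expr0 mul1r subrr.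
have sYk := vsmooth_derive1n k oJ sY.
have E : exact_on J a b (fun u => '[X u, Y^`(k) u])^`().
  exists (fun u => '[X u, Y^`(k) u]); split=> //; first exact: smooth_dot.
  - by have [-> _] := Y0 k; rewrite dotC -(scale0r 0) dotZl mul0r.
  - by have [_ ->] := Y0 k; rewrite dotC -(scale0r 0) dotZl mul0r.
(* The induction hypothesis for X' is subtracted from the derivative of <X, Y^(k)>: the terms <X',
   Y^(k)> cancel and the sign alternates. *)
have := exactD oJ E (exactZ (-1) oJ (IH _ (vsmooth_derive1 oJ sX))).
apply: eq_on_exact => s /set_mem Js.
by rewrite (derive1_dot oJ sX sYk Js) (derive1Sn X) (derive1nS Y) exprS; ring.
Qed.

End curves.

(** * Unit speed curves in the sphere and the first variation integrand *)

Section unit_speed.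
Context {R : realType} {n : nat}.
Implicit Types (J : set R^o) (c z X Y : R^o -> 'rV[R]_n).

Lemma dotNl (u w : 'rV[R]_n) : '[- u, w] = - '[u, w].
Proof. by rewrite -scaleN1r dotZl mulN1r. Qed.

Lemma derive1_dot_cst {J X Y} (k : R) : open J -> vsmooth J X -> vsmooth J Y ->
  (forall s, J s -> '[X s, Y s] = k) ->
  forall s, J s -> '[X^`() s, Y s] + '[X s, Y^`() s] = 0.
Proof.
move=> oJ sX sY XY s Js; rewrite -(derive1_dot oJ sX sY Js).
have XYk : {in J, (fun s => '[X s, Y s]) =1 cst k} by move=> u /set_mem; exact: XY.
by rewrite (eq_on_derive1 oJ XYk) ?inE// derive1_cst.
Qed.

(** Repeated differentiation of |c|^2 = 1 and |c'|^2 = 1; each relation comes from the derivative of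
    an earlier one. *)
Lemma unit_speed_dots {J c} : open J -> vsmooth J c ->
  (forall s, J s -> '[c s, c s] = 1) ->
  (forall s, J s -> '[c^`() s, c^`() s] = 1) ->
  forall s, J s -> [/\ '[c s, c^`() s] = 0, '[c s, c^`(2) s] = - 1,
    '[c^`() s, c^`(2) s] = 0, '[c^`() s, c^`(3) s] = - '[c^`(2) s, c^`(2) s] &
    '[c s, c^`(4) s] = '[c^`(2) s, c^`(2) s]].
Proof.
move=> oJ sc cc c11 s Js.
have s1 := vsmooth_derive1 oJ sc.
have s2 : vsmooth J c^`(2) := vsmooth_derive1n 2 oJ sc.
have s3 : vsmooth J c^`(3) := vsmooth_derive1n 3 oJ sc.
have c01 u : J u -> '[c u, c^`() u] = 0.
  move=> Ju; have := derive1_dot_cst 1 oJ sc sc cc _ Ju.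
  by rewrite (dotC _ (c u)) => /eqP; rewrite -mulr2n mulrn_eq0 /= => /eqP.
have c12 u : J u -> '[c^`() u, c^`(2) u] = 0.
  move=> Ju; have := derive1_dot_cst 1 oJ s1 s1 c11 _ Ju.
  by rewrite (dotC _ (c^`() u)) => /eqP; rewrite -mulr2n mulrn_eq0 /= => /eqP.
have c02 u : J u -> '[c u, c^`(2) u] = - 1.
  move=> Ju; have := derive1_dot_cst 0 oJ sc s1 c01 _ Ju.
  by rewrite c11// => /eqP; rewrite addrC addr_eq0 => /eqP.
have c03 u : J u -> '[c u, c^`(3) u] = 0.
  move=> Ju; have := derive1_dot_cst (- 1) oJ sc s2 c02 _ Ju.
  by rewrite c12// add0r.
have c13 u : J u -> '[c^`() u, c^`(3) u] = - '[c^`(2) u, c^`(2) u].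
  move=> Ju; have := derive1_dot_cst 0 oJ s1 s2 c12 _ Ju.
  by move=> /eqP; rewrite addrC addr_eq0 => /eqP.
split; [exact: c01|exact: c02|exact: c12|exact: c13|].
have cancel (x y k : R) : x + y = 0 -> x = - k -> y = k.
  by move=> + xk; rewrite xk => /eqP; rewrite addrC subr_eq0 => /eqP.
exact: cancel (derive1_dot_cst 0 oJ sc s3 c03 _ Js) (c13 s Js).
Qed.

(* The vectors stand for derivatives at one point: [ci] for c^(i), [zi] for
   z^(i), [Wi] and [Ai] for the i-th derivatives of W and |c''|^2 c, and [X1],
   [X2], [X3] for (m c')', (f c')'', (f c'')', where m = <W, c''>, f = <W, c'>. *)
Lemma first_variation_algebra 
    {c0 c1 c2 c4 c6 c8 W W2 W4 A2 A4 X1 X2 X3 z0 z1 z2 z4 : 'rV[R]_n}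
    {q q1 q2 h h1 m f lam : R} :
  q = '[c2, c2] -> h = '[c4, c2] -> f = '[c4, c1] -> m = h + (q + q) + -1 ->
  W = c4 + c2 + (1 + -1 * q) *: c0 ->
  '[c0, c1] = 0 -> '[c0, c2] = -1 -> '[c1, c2] = 0 -> '[c0, z0] = 0 ->
  W4 + A4 = c8 + c6 + c4 -> W2 + A2 = c6 + c4 + c2 ->
  A2 = (q2 *: c0 + q1 *: c1) + (q1 *: c1 + q *: c2) ->
  X1 = (h1 + (q1 + q1)) *: c1 + m *: c2 ->
  0 = c8 + 2 *: c6 + 3 *: c4 - q *: c4 - (6 * q) *: c2 + 4 *: c2
      - (2 * h) *: c2 + 5 *: X2 - A4 - (6 * q1) *: c1 - (2 * h1) *: c1 - 5 *: X3
      - lam *: c0 ->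
  ('[W, z4] - (-1) ^+ 4 * '[W4, z0]) + ('[W, z2] - (-1) ^+ 2 * '[W2, z0])
  + (2 * ('[m *: c1, z1] - (-1) ^+ 1 * '[X1, z0])
     + (5 * ('[f *: c1, z2] - (-1) ^+ 2 * '[X2, z0])
        + 5 * ('[f *: c2, z1] - (-1) ^+ 1 * '[X3, z0])))
  = '[W, z4] + '[W, z2] + 2 * '[W, c2] * '[c1, z1]
    + 5 * '[W, c1] * ('[c1, z2] + '[c2, z1]) + (1 - q) * '[W, z0].
Proof.
move=> qE hE fE mE WE c01 c02 c12 cz WA4 WA2 A2E X1E eqn.
have W4E : '[W4, z0] = '[c8 + c6 + c4 - A4, z0] by rewrite -WA4 addrK.
have W2E : '[W2, z0] = '[c6 + c4 + c2 - A2, z0] by rewrite -WA2 addrK.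
have Wc1 : '[W, c1] = f.
  by rewrite WE !dotDl dotZl c01 (dotC c2) c12 -fE; ring.
have Wc2 : '[W, c2] = m.
  by rewrite WE !dotDl dotZl c02 mE -qE -hE; ring.
have Wz : '[W, z0] = '[c4, z0] + '[c2, z0].
  by rewrite WE !dotDl dotZl cz; ring.
(* The equation is paired with [z0]. Its zero is written as [0 *: c0] so that bilinearity treats it
   like the other terms; the resulting scalar relation is then added to the left side. *)
have := congr1 (fun u => '[u, z0]) eqn; rewrite /= -(scale0r c0).
rewrite W4E W2E A2E X1E Wc1 Wc2 Wz !(dotDl, dotNl, dotZl) cz.
by move=> H; rewrite -[LHS]addr0 -{2}(mul0r 0) H mE; ring.
Qed.

(* nabla^3 c' for a unit speed curve c in the sphere. *)
Definition tension4 c (s : R) : 'rV[R]_n :=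
  c^`(4) s + c^`(2) s + (1 + -1 * '[c^`(2) s, c^`(2) s]) *: c s.

Lemma vsmooth_tension4 {J c} : open J -> vsmooth J c -> vsmooth J (tension4 c).
Proof.
move=> oJ sc; have sk k := vsmooth_derive1n k oJ sc.
apply: vsmoothD => //; first exact: vsmoothD oJ (sk 4%N) (sk 2%N).
apply: (vsmoothZ oJ _ sc); apply: (smoothD oJ (smooth_cst J 1)).
exact: smoothM oJ (smooth_cst J _) (smooth_dot oJ (sk 2%N) (sk 2%N)).
Qed.

(** The integrand is half the t-derivative of the energy density at t = 0, with [z] the variation
    field. The coefficient [lam] is free: it multiplies [c], and the equation is only paired with
    [z], which is orthogonal to [c]. *)
Lemma exact_first_variation {J c z} {a b : R} (lam : R -> R) : open J ->
  vsmooth J c -> vsmooth J z ->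
  (forall s, J s -> '[c s, c s] = 1) ->
  (forall s, J s -> '[c^`() s, c^`() s] = 1) ->
  (forall s, J s -> '[c s, z s] = 0) ->
  (forall l, z^`(l) a = 0 /\ z^`(l) b = 0) ->
  (forall s, J s ->
    0 = c^`(8) s + 2 *: c^`(6) s + 3 *: c^`(4) s
        - '[c^`(2) s, c^`(2) s] *: c^`(4) s
        - (6 * '[c^`(2) s, c^`(2) s]) *: c^`(2) s
        + 4 *: c^`(2) s
        - (2 * '[c^`(4) s, c^`(2) s]) *: c^`(2) s
        + 5 *: (fun u => '[c^`(4) u, c^`() u] *: c^`() u)^`(2) s
        - (fun u => '[c^`(2) u, c^`(2) u] *: c u)^`(4) s
        - (6 * (fun u => '[c^`(2) u, c^`(2) u])^`() s) *: c^`() s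
        - (2 * (fun u => '[c^`(4) u, c^`(2) u])^`() s) *: c^`() s
        - 5 *: (fun u => '[c^`(4) u, c^`() u] *: c^`(2) u)^`() s
        - lam s *: c s) ->
  exact_on J a b (fun s => let W := tension4 c s in
    '[W, z^`(4) s] + '[W, z^`(2) s]
    + 2 * '[W, c^`(2) s] * '[c^`() s, z^`() s]
    + 5 * '[W, c^`() s] * ('[c^`() s, z^`(2) s] + '[c^`(2) s, z^`() s])
    + (1 - '[c^`(2) s, c^`(2) s]) * '[W, z s]).
Proof.
move=> oJ sc sz cc c11 cz z0 eqn.
have sk k := vsmooth_derive1n k oJ sc.
have s1 := vsmooth_derive1 oJ sc.
have sW := vsmooth_tension4 oJ sc.
have dots := unit_speed_dots oJ sc cc c11.
pose q (s : R^o) := '[c^`(2) s, c^`(2) s].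
pose h (s : R^o) := '[c^`(4) s, c^`(2) s].
(* This is h + q + (1 - q)<c, c''> with <c, c''> = -1. *)
pose m (s : R^o) := h s + (q s + q s) + -1.
pose f (s : R^o) := '[c^`(4) s, c^`() s].
have sq : smooth J q := smooth_dot oJ (sk 2%N) (sk 2%N).
have sh : smooth J h := smooth_dot oJ (sk 4%N) (sk 2%N).
have sf : smooth J f := smooth_dot oJ (sk 4%N) s1.
have sqq := smoothD oJ sq sq.
have shqq := smoothD oJ sh sqq.
have sm : smooth J m := smoothD oJ shqq (smooth_cst J _).
have sX1 := vsmoothZ oJ sm s1.
have sX2 := vsmoothZ oJ sf s1.
have sX3 := vsmoothZ oJ sf (sk 2%N).
(* One integration by parts for each term that contains a derivative of [z]; the term (1 - q)<W, z>
   is already in final form. *)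
have E1 := exact_ibp 4 _ _ oJ sW sz z0.
have E2 := exact_ibp 2 _ _ oJ sW sz z0.
have E3 := exactZ 2 oJ (exact_ibp 1 _ _ oJ sX1 sz z0).
have E4 := exactZ 5 oJ (exact_ibp 2 _ _ oJ sX2 sz z0).
have E5 := exactZ 5 oJ (exact_ibp 1 _ _ oJ sX3 sz z0).
have := exactD oJ (exactD oJ E1 E2) (exactD oJ E3 (exactD oJ E4 E5)).
apply: eq_on_exact => s /set_mem Js /=.
have [c01 c02 c12 _ _] := dots s Js.
(* Adding q c turns W into c^(4) + c'' + c, whose derivatives need no product rule. The fourth
   derivative of q c thus stays whole, as it does in the equation. *)
have WE k : (tension4 c)^`(k) s + (fun u => q u *: c u)^`(k) s =
    c^`(k + 4) s + c^`(k + 2) s + c^`(k) s.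
  rewrite -(derive1n_vD k oJ sW (vsmoothZ oJ sq sc)) ?inE//.
  have -> : (fun u : R^o => tension4 c u + q u *: c u) =
      (fun u => c^`(4) u + c^`(2) u + c u).
    apply/funext => u; rewrite /tension4 -addrA -scalerDl -/(q u).
    by rewrite mulN1r subrK scale1r.
  rewrite (derive1n_vD k oJ (vsmoothD oJ (sk 4%N) (sk 2%N)) sc) ?inE//.
  rewrite (derive1n_vD k oJ (sk 4%N) (sk 2%N)) ?inE//.
  by rewrite /derive1n !iterD.
have sq' := smooth_derive1 sq.
(* The second derivative of q c has to be expanded: the equation contains its c' and c'' parts
   merged with other terms, and its q'' c part is orthogonal to [z]. *)
have q2 : (fun u => q u *: c u)^`(2) s =
    (q^`(2) s *: c s + q^`() s *: c^`() s) + (q^`() s *: c^`() s + q s *: c^`(2) s).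
  rewrite derive1nS derive1n1.
  have H : {in J, (fun u => q u *: c u)^`() =1
      (fun u => q^`() u *: c u + q u *: c^`() u)}.
    by move=> u /set_mem Ju; rewrite (derive1_vZ oJ sq sc Ju).
  rewrite (eq_on_derive1 oJ H) ?inE//.
  rewrite (derive1_vD (vsmoothZ oJ sq' sc) (vsmoothZ oJ sq s1) Js).
  by rewrite (derive1_vZ oJ sq' sc Js) (derive1_vZ oJ sq s1 Js).
have m1 : (fun u => m u *: c^`() u)^`(1) s =
    (h^`() s + (q^`() s + q^`() s)) *: c^`() s + m s *: c^`(2) s.
  rewrite derive1n1 (derive1_vZ oJ sm s1 Js); congr (_ *: _ + _).
  rewrite (derive1_D shqq (smooth_cst J _) Js) (derive1_D sh sqq Js).
  by rewrite (derive1_D sq sq Js) derive1_cst addr0.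
exact: (first_variation_algebra (erefl (q s)) (erefl (h s)) (erefl (f s))
  (erefl (m s)) (erefl (tension4 c s)) c01 c02 c12 (cz s Js)
  (WE 4%N) (WE 2%N) q2 m1 (eqn s Js)).
Qed.

End unit_speed.

(** * Maps into the sphere and the derivative of the energy density *)

Section sphere_map.
Context {R : realType} {V : normedModType R} {n : nat}.
Implicit Types (O : set V) (G X : V -> 'rV[R]_n) (v w : V).

Lemma vschwarz {O X} v w : open O -> vsmooth O X ->
  {in O, 'D_v ('D_w X) =1 'D_w ('D_v X)}.
Proof.
move=> oO sX x /set_mem Ox; apply/rowP => i.
have sX1 := vsmooth_derive w oO sX; have sX2 := vsmooth_derive v oO sX.
apply: etrans (vsmooth_derive_coord v i sX1 Ox) _.
apply: etrans _ (esym (vsmooth_derive_coord w i sX2 Ox)).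
have E1 : {in O, (fun y => 'D_w X y ord0 i) =1 'D_w (fun y => X y ord0 i)}.
  by move=> y /set_mem Oy; exact: vsmooth_derive_coord sX Oy.
have E2 : {in O, (fun y => 'D_v X y ord0 i) =1 'D_v (fun y => X y ord0 i)}.
  by move=> y /set_mem Oy; exact: vsmooth_derive_coord sX Oy.
have xO : x \in O by rewrite inE.
apply: etrans (eq_on_derive v oO E1 _ xO) _.
apply: etrans _ (esym (eq_on_derive w oO E2 _ xO)).
exact: schwarz oO (sX i) Ox.
Qed.

Lemma vsmooth_iter_derive {O X} k w : open O -> vsmooth O X ->
  vsmooth O (iter k (fun Y => 'D_w Y) X).
Proof. by move=> oO sX; elim: k => [//|k IH]; exact: vsmooth_derive. Qed.

(** With [v] the t-direction and [w] the s-direction, this turns the t-derivative of the k-th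
    s-derivative into the k-th derivative of the variation field. *)
Lemma derive_iter_derive {O X} k v w : open O -> vsmooth O X ->
  {in O, 'D_v (iter k (fun Y => 'D_w Y) X) =1 iter k (fun Y => 'D_w Y) ('D_v X)}.
Proof.
move=> oO sX; elim: k => [//|k IH] x xO.
apply: etrans (vschwarz v w oO (vsmooth_iter_derive k w oO sX) _ xO) _.
exact: (eq_on_derive w oO IH _ xO).
Qed.

Lemma derive_cstM {O} {f : V -> R} {x} k v : smooth O f -> O x ->
  'D_v (fun y => k * f y) x = k * 'D_v f x.
Proof. by move=> sf Ox; exact: (deriveZ k (smooth_derivable v sf Ox)). Qed.

(** The operator [nabla] for a whole family of curves at once; being defined on the domain of the
    family, the result can also be differentiated across it. *)
Definition nabla_dir G w X : V -> 'rV[R]_n :=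
  fun p => 'D_w X p + '[X p, 'D_w G p] *: G p.

(** [d] is the derivative of the first covariant derivative g2 + |g1|^2 g. The 3 is 2 from
    differentiating |g1|^2 plus 1 from the correction <g2, g1> g. *)
Lemma nabla2_algebra (g g1 g2 g3 d : 'rV[R]_n) : '[g, g1] = 0 ->
  d = g3 + (('[g2, g1] + '[g1, g2]) *: g + '[g1, g1] *: g1) ->
  d + '[g2 + '[g1, g1] *: g, g1] *: g =
  g3 + '[g1, g1] *: g1 + (3 * '[g1, g2]) *: g.
Proof.
move=> gg1 ->; rewrite dotDl dotZl gg1 (dotC g2 g1).
by apply/rowP => i; rewrite !mxE; ring.
Qed.

(** [e] is the second covariant derivative and [d] its derivative. The 5 is 2 from differentiating
    |g1|^2 in front of g1 plus 3 from differentiating g in 3<g1, g2> g. *)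
Lemma nabla3_algebra (g g1 g2 g3 g4 d e : 'rV[R]_n) : '[g, g1] = 0 ->
  d = g4 + (('[g2, g1] + '[g1, g2]) *: g1 + '[g1, g1] *: g2)
      + ((3 * ('[g2, g2] + '[g1, g3])) *: g + (3 * '[g1, g2]) *: g1) ->
  e = g3 + '[g1, g1] *: g1 + (3 * '[g1, g2]) *: g ->
  d + '[e, g1] *: g =
  g4 + '[g1, g1] *: g2 + (5 * '[g1, g2]) *: g1
  + (3 * ('[g2, g2] + '[g1, g3]) + ('[g3, g1] + '[g1, g1] * '[g1, g1])) *: g.
Proof.
move=> gg1 -> ->; rewrite !dotDl !dotZl gg1 (dotC g2 g1).
by apply/rowP => i; rewrite !mxE; ring.
Qed.

Lemma nabla3_expansion {O G} w : open O -> vsmooth O G ->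
  (forall p, O p -> '[G p, G p] = 1) ->
  let g k := iter k (fun Y => 'D_w Y) G in
  {in O, iter 3 (nabla_dir G w) (g 1%N) =1 fun p =>
    g 4%N p + '[g 1%N p, g 1%N p] *: g 2%N p
    + (5 * '[g 1%N p, g 2%N p]) *: g 1%N p
    + (3 * ('[g 2%N p, g 2%N p] + '[g 1%N p, g 3%N p])
       + ('[g 3%N p, g 1%N p] + '[g 1%N p, g 1%N p] * '[g 1%N p, g 1%N p])) *: G p}.
Proof.
move=> oO sG GG g.
have sg k : vsmooth O (g k) := vsmooth_iter_derive k w oO sG.
have gg1 p : O p -> '[G p, g 1%N p] = 0.
  move=> Op; have := derive_dot w oO sG sG Op.
  have E : {in O, (fun q => '[G q, G q]) =1 cst 1} by move=> q /set_mem; exact: GG.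
  have -> : 'D_w (fun q => '[G q, G q]) p = 0.
    by rewrite (eq_on_derive w oO E) ?inE// derive_cst.
  rewrite (dotC _ (G p)) => /esym/eqP; rewrite -mulr2n mulrn_eq0 /=.
  by move/eqP.
have s11 := smooth_dot oO (sg 1%N) (sg 1%N).
have s12 := smooth_dot oO (sg 1%N) (sg 2%N).
have s312 := smoothM oO (smooth_cst O 3) s12.
have sA := vsmoothZ oO s11 sG.
have sB := vsmoothZ oO s11 (sg 1%N).
have sC := vsmoothZ oO s312 sG.
have N2 : {in O, nabla_dir G w (nabla_dir G w (g 1%N)) =1 fun p =>
    g 3%N p + '[g 1%N p, g 1%N p] *: g 1%N p + (3 * '[g 1%N p, g 2%N p]) *: G p}.
  move=> p /set_mem Op; apply: nabla2_algebra; first exact: gg1.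
  apply: etrans (derive_vD w (sg 2%N) sA Op) _; congr (_ + _).
  apply: etrans (derive_vZ w oO s11 sG Op) _; congr (_ *: _ + _).
  exact: derive_dot oO (sg 1%N) (sg 1%N) Op.
move=> p pO; have Op : O p by move/set_mem: pO.
apply: nabla3_algebra (N2 p pO); first exact: gg1.
apply: etrans (eq_on_derive w oO N2 _ pO) _.
apply: etrans (derive_vD w (vsmoothD oO (sg 3%N) sB) sC Op) _; congr (_ + _).
  apply: etrans (derive_vD w (sg 3%N) sB Op) _; congr (_ + _).
  apply: etrans (derive_vZ w oO s11 (sg 1%N) Op) _; congr (_ *: _ + _).
  exact: derive_dot oO (sg 1%N) (sg 1%N) Op.
apply: etrans (derive_vZ w oO s312 sG Op) _; congr (_ *: _ + _).
apply: etrans (derive_cstM 3 w s12 Op) _; congr (_ * _).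
exact: derive_dot oO (sg 1%N) (sg 2%N) Op.
Qed.

(** [e] is the third covariant derivative and [d] its derivative across the family. With q = |g2|^2,
    unit speed makes the coefficient of g in [e] equal to 3(q - q) - q + 1 = 1 - q, so e = W. As <W,
    g> = q - 1 + (1 - q) = 0, the derivative [a] of that coefficient may be any number. *)
Lemma derive_density_algebra (g g1 g2 g3 g4 z z1 z2 z4 d e W : 'rV[R]_n) (a : R) :
  '[g, g1] = 0 -> '[g, g2] = -1 -> '[g1, g1] = 1 -> '[g1, g2] = 0 ->
  '[g1, g3] = - '[g2, g2] -> '[g, g4] = '[g2, g2] ->
  e = g4 + '[g1, g1] *: g2 + (5 * '[g1, g2]) *: g1
    + (3 * ('[g2, g2] + '[g1, g3]) + ('[g3, g1] + '[g1, g1] * '[g1, g1])) *: g ->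
  d = z4 + (('[z1, g1] + '[g1, z1]) *: g2 + '[g1, g1] *: z2)
    + ((5 * ('[z1, g2] + '[g1, z2])) *: g1 + (5 * '[g1, g2]) *: z1)
    + (a *: g + (3 * ('[g2, g2] + '[g1, g3])
                 + ('[g3, g1] + '[g1, g1] * '[g1, g1])) *: z) ->
  W = g4 + g2 + (1 + -1 * '[g2, g2]) *: g ->
  '[g, g] = 1 ->
  '[d, e] + '[e, d] = 2 * ('[W, z4] + '[W, z2] + 2 * '[W, g2] * '[g1, z1]
    + 5 * '[W, g1] * ('[g1, z2] + '[g2, z1]) + (1 - '[g2, g2]) * '[W, z]).
Proof.
move=> gg1 gg2 g11 g12 g13 gg4 + + WE gg.
rewrite (dotC g3) g13 g12 g11 => eE dE.
have {}eE : e = W by rewrite eE WE; apply/rowP => i; rewrite !mxE; ring.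
have Wg : '[W, g] = 0.
  by rewrite WE !dotDl dotZl gg (dotC g4) (dotC g2 g) gg4 gg2; ring.
rewrite (dotC d) eE dE !(dotDr, dotZr) Wg (dotC z1 g1) (dotC z1 g2).
by ring.
Qed.

Lemma derive_density {O G} v w (p : V) : open O -> vsmooth O G ->
  (forall p, O p -> '[G p, G p] = 1) -> O p ->
  let g k := iter k (fun Y => 'D_w Y) G in
  let z k := iter k (fun Y => 'D_w Y) ('D_v G) in
  let N := iter 3 (nabla_dir G w) (g 1%N) in
  let W := g 4%N p + g 2%N p + (1 + -1 * '[g 2%N p, g 2%N p]) *: G p in
  '[G p, g 1%N p] = 0 -> '[G p, g 2%N p] = -1 -> '[g 1%N p, g 1%N p] = 1 ->
  '[g 1%N p, g 2%N p] = 0 -> '[g 1%N p, g 3%N p] = - '[g 2%N p, g 2%N p] ->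
  '[G p, g 4%N p] = '[g 2%N p, g 2%N p] ->
  'D_v (fun y => '[N y, N y]) p =
  2 * ('[W, z 4%N p] + '[W, z 2%N p] + 2 * '[W, g 2%N p] * '[g 1%N p, z 1%N p]
    + 5 * '[W, g 1%N p] * ('[g 1%N p, z 2%N p] + '[g 2%N p, z 1%N p])
    + (1 - '[g 2%N p, g 2%N p]) * '[W, 'D_v G p]).
Proof.
move=> oO sG GG Op g z N W gg1 gg2 g11 g12 g13 gg4.
have pO : p \in O by rewrite inE.
have sg k : vsmooth O (g k) := vsmooth_iter_derive k w oO sG.
have dg k : 'D_v (g k) p = z k p := derive_iter_derive k v w oO sG _ pO.
have sgg k l := smooth_dot oO (sg k) (sg l).
have dgg k l : 'D_v (fun y => '[g k y, g l y]) p = '[z k p, g l p] + '[g k p, z l p].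
  by rewrite -!dg; exact: derive_dot oO (sg k) (sg l) Op.
pose mu y := 3 * ('[g 2%N y, g 2%N y] + '[g 1%N y, g 3%N y])
  + ('[g 3%N y, g 1%N y] + '[g 1%N y, g 1%N y] * '[g 1%N y, g 1%N y]).
have smu : smooth O mu := smoothD oO
  (smoothM oO (smooth_cst O 3) (smoothD oO (sgg 2%N 2%N) (sgg 1%N 3%N)))
  (smoothD oO (sgg 3%N 1%N) (smoothM oO (sgg 1%N 1%N) (sgg 1%N 1%N))).
have sA := vsmoothZ oO (sgg 1%N 1%N) (sg 2%N).
have s512 := smoothM oO (smooth_cst O 5) (sgg 1%N 2%N).
have sB := vsmoothZ oO s512 (sg 1%N).
have sC := vsmoothZ oO smu sG.
have sAB := vsmoothD oO (vsmoothD oO (sg 4%N) sA) sB.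
have NE := nabla3_expansion w oO sG GG.
have NNE : {in O, (fun y => '[N y, N y]) =1 fun y =>
    '[g 4%N y + '[g 1%N y, g 1%N y] *: g 2%N y + (5 * '[g 1%N y, g 2%N y]) *: g 1%N y
      + mu y *: G y,
      g 4%N y + '[g 1%N y, g 1%N y] *: g 2%N y + (5 * '[g 1%N y, g 2%N y]) *: g 1%N y
      + mu y *: G y]}.
  by move=> y yO /=; congr dot; exact: NE.
apply: etrans (eq_on_derive v oO NNE _ pO) _.
apply: etrans (derive_dot v oO (vsmoothD oO sAB sC) (vsmoothD oO sAB sC) Op) _.
apply: (derive_density_algebra _ _ _ (g 3%N p) _ _ _ _ _ _ _ _ ('D_v mu p)
  gg1 gg2 g11 g12 g13 gg4 erefl _ erefl (GG p Op)).
apply: etrans (derive_vD v sAB sC Op) _; congr (_ + _); last first.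
  exact: derive_vZ oO smu sG Op.
apply: etrans (derive_vD v (vsmoothD oO (sg 4%N) sA) sB Op) _; congr (_ + _).
  apply: etrans (derive_vD v (sg 4%N) sA Op) _; rewrite dg; congr (_ + _).
  apply: etrans (derive_vZ v oO (sgg 1%N 1%N) (sg 2%N) Op) _.
  by rewrite dgg dg.
apply: etrans (derive_vZ v oO s512 (sg 1%N) Op) _.
by rewrite dg (derive_cstM 5 v (sgg 1%N 2%N) Op) dgg.
Qed.

(** The derivatives at [p] become named vectors, so that at p = (0, s) those of the curve and of the
    variation field enter through equations, without rewriting under iterated operators. *)
Lemma derive_density_at {O G} v w (p : V) (c0 c1 c2 c3 c4 z0 z1 z2 z4 : 'rV[R]_n) :
  open O -> vsmooth O G -> (forall p, O p -> '[G p, G p] = 1) -> O p ->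
  let g k := iter k (fun Y => 'D_w Y) G in
  let z k := iter k (fun Y => 'D_w Y) ('D_v G) in
  let N := iter 3 (nabla_dir G w) (g 1%N) in
  G p = c0 -> g 1%N p = c1 -> g 2%N p = c2 -> g 3%N p = c3 -> g 4%N p = c4 ->
  'D_v G p = z0 -> z 1%N p = z1 -> z 2%N p = z2 -> z 4%N p = z4 ->
  [/\ '[c0, c1] = 0, '[c0, c2] = -1, '[c1, c2] = 0, '[c1, c3] = - '[c2, c2] &
    '[c0, c4] = '[c2, c2]] -> '[c1, c1] = 1 ->
  let W := c4 + c2 + (1 + -1 * '[c2, c2]) *: c0 in
  'D_v (fun y => '[N y, N y]) p =
  2 * ('[W, z4] + '[W, z2] + 2 * '[W, c2] * '[c1, z1]
    + 5 * '[W, c1] * ('[c1, z2] + '[c2, z1]) + (1 - '[c2, c2]) * '[W, z0]).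
Proof.
move=> oO sG GG Op g z N <- <- <- <- <- <- <- <- <- [c01 c02 c12 c13 c04] c11 W.
exact: (derive_density v w p oO sG GG Op c01 c02 c11 c12 c13 c04).
Qed.

Lemma vsmooth_nabla_dir {O G X} w : open O -> vsmooth O G -> vsmooth O X ->
  vsmooth O (nabla_dir G w X).
Proof.
move=> oO sG sX; apply: (vsmoothD oO (vsmooth_derive w oO sX)).
exact: vsmoothZ oO (smooth_dot oO sX (vsmooth_derive w oO sG)) sG.
Qed.

End sphere_map.

(** * The energy of a variation, and the theorem *)

Section variation.
Context {R : realType} {n : nat}.
Local Notation V := (R^o * R^o)%type.
Local Notation e1 := ((1, 0) : V).
Local Notation e2 := ((0, 1) : V).
Implicit Types (G : V -> 'rV[R]_n.+1).

(** It holds at every point and for every [G], since it rests only on the coincidence of difference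
    quotients on slices. *)
Lemma iter_nabla_second_slice k G t :
  iter k (nabla (fun s => G (t, s))) (fun s : R => G (t, s))^`() =
  fun s => iter k (nabla_dir G e2) ('D_e2 G) (t, s).
Proof.
elim: k => [|k IH]; first by apply/funext => s; exact: derive1_second_slice.
rewrite iterS IH; apply/funext => s; rewrite /nabla.
by rewrite !derive1_second_slice.
Qed.

Lemma energy4_slice (a b t : R) G : energy 4 a b (fun s => G (t, s)) =
  2^-1 * \int[lebesgue_measure]_(s in `[a, b])
    (fun p => '[iter 3 (nabla_dir G e2) ('D_e2 G) p,
                iter 3 (nabla_dir G e2) ('D_e2 G) p]) (t, s).
Proof.
rewrite /energy; congr (_ * _); apply: eq_Rintegral => s _.
by rewrite enorm_sqr (iter_nabla_second_slice 3 G t).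
Qed.

(** Puts the given equation into inner products and merges its two multiples of the curve into the
    single coefficient that [exact_first_variation] expects. *)
Lemma eqn_norm_dot {x8 x6 x4 x2 x1 x0 A B P P' : 'rV[R]_n} {E q p p' h h' l k : R} :
  0 = x8 + 2 *: x6 + 3 *: x4 - E *: x4 - (6 * E) *: x2 + 4 *: x2
      - (2 * h) *: x2 + 5 *: A - P - (6 * p) *: x1 - (2 * h') *: x1
      - 5 *: B - l *: x0 - k *: x0 ->
  E = q -> P = P' -> p = p' ->
  0 = x8 + 2 *: x6 + 3 *: x4 - q *: x4 - (6 * q) *: x2 + 4 *: x2
      - (2 * h) *: x2 + 5 *: A - P' - (6 * p') *: x1 - (2 * h') *: x1
      - 5 *: B - (l + k) *: x0.
Proof. by move=> + <- <- <-; rewrite (scalerDl x0 l k) (opprD (l *: x0)) !addrA. Qed.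

End variation.

Theorem theorem1p1 (R : realType) (n : nat) (I : set R)
    (c : R -> 'rV[R]_n.+1) :
  is_interval I ->
  smooth_on (V := R^o) I c ->
  (forall s, I s -> sphere R n (c s)) ->
  (forall s, I s -> enorm (c^`() s) = 1) ->
  ~ geodesic I c ->
  (forall s, I s ->
    0 = c^`(8) s + 2 *: c^`(6) s + 3 *: c^`(4) s
        - enorm (c^`(2) s) ^+ 2 *: c^`(4) s
        - (6 * enorm (c^`(2) s) ^+ 2) *: c^`(2) s
        + 4 *: c^`(2) s
        - (2 * '[c^`(4) s, c^`(2) s]) *: c^`(2) s
        + 5 *: (fun u => '[c^`(4) u, c^`() u] *: c^`() u)^`(2) s
        - (fun u => enorm (c^`(2) u) ^+ 2 *: c u)^`(4) s
        - (6 * (fun u => enorm (c^`(2) u) ^+ 2 : R)^`() s) *: c^`() s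
        - (2 * (fun u => '[c^`(4) u, c^`(2) u] : R)^`() s) *: c^`() s
        - 5 *: (fun u => '[c^`(4) u, c^`() u] *: c^`(2) u)^`() s
        - ('[c^`(8) s, c s] + 2 * '[c^`(6) s, c s]
           + 3 * enorm (c^`(2) s) ^+ 2 - enorm (c^`(2) s) ^+ 4
           + 6 * enorm (c^`(2) s) ^+ 2 - 4
           + 2 * '[c^`(4) s, c^`(2) s]) *: c s
        - (5 * '[c s, (fun u => '[c^`(4) u, c^`() u] *: c^`() u)^`(2) s]
           - '[c s, (fun u => enorm (c^`(2) u) ^+ 2 *: c u)^`(4) s]
           - 5 * '[c s, (fun u => '[c^`(4) u, c^`() u] *: c^`(2) u)^`() s])
          *: c s) ->
  proper_r_harmonic 4 I c.
Proof.
move=> _ _ csph cspeed ngeo eqn; split=> //.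
move=> a b e G ab abJ e0 [[U [oU AU dG]] Gsph G0 Gout].
pose V := (R^o * R^o)%type.
pose e1 : V := (1, 0).
pose e2 : V := (0, 1).
(* [G (0, s)] equals [c s] on [I] only, and equality of the s-derivatives follows on an open set;
   the support [a, b] lies inside this one. *)
pose J : set R^o := I°.
have JI s : J s -> I s by exact: interior_subset.
have oJ : open J by exact: open_interior.
pose T : set R^o := [set t | - e < t < e].
have T0 : T 0 by rewrite /T /= oppr_lt0 e0.
have oT : open T.
  have -> : T = `](- e), e[ by rewrite set_itvoo.
  exact: interval_open.
pose O : set V := T `*` J.
have oO : open O.
  rewrite openE => -[t s] [Tt Js]; exists (T, J) => //.
  by split; exact: open_nbhs_nbhs.
have O0 s : J s -> O (0, s) by [].
have sG : vsmooth O G.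
  apply: vsmooth_sub (differentiable_vsmooth _ _ oU dG).
  by move=> [t s] [Tt Js]; apply: AU; split=> //; exact: JI.
have GG p : O p -> '[G p, G p] = 1.
  case: p => t s [Tt Js]; rewrite -enorm_sqr.
  by rewrite (Gsph t s Tt (JI _ Js)) expr1n.
have cG : {in J, (fun s => G (0, s)) =1 c}.
  by move=> s /set_mem Js; exact: G0 (JI _ Js).
have sc : vsmooth J c := eq_on_vsmooth oJ cG (vsmooth_second_slice O J 0 G O0 sG).
pose z (s : R^o) := 'D_e1 G (0, s).
have sz : vsmooth J z :=
  vsmooth_second_slice O J 0 _ O0 (vsmooth_derive e1 oO sG).
have cc s : J s -> '[c s, c s] = 1.
  by move=> Js; rewrite -enorm_sqr (csph s (JI _ Js)) expr1n.
have c11 s : J s -> '[c^`() s, c^`() s] = 1.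
  by move=> Js; rewrite -enorm_sqr (cspeed s (JI _ Js)) expr1n.
have cz s : J s -> '[c s, z s] = 0.
  move=> Js; have Os := O0 s Js.
  have GG1 : {in O, (fun p => '[G p, G p]) =1 cst 1}.
    by move=> p /set_mem; exact: GG.
  have : 'D_e1 (fun p => '[G p, G p]) (0, s) = 0.
    by rewrite (eq_on_derive e1 oO GG1) ?inE// derive_cst.
  rewrite (derive_dot e1 oO sG sG Os) (G0 s (JI _ Js)) dotC.
  by move=> /eqP; rewrite -mulr2n mulrn_eq0 /= => /eqP.
have z0 l : z^`(l) a = 0 /\ z^`(l) b = 0.
  apply: (derive1n_vanish l oJ ab abJ sz) => s Js abs.
  have Gc : {in T, (fun u : R^o => G (u, s)) =1 cst (c s)}.
    by move=> u /set_mem Tu; exact: Gout (JI _ Js) abs.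
  rewrite /z -derive1_first_slice.
  by rewrite (eq_on_derive1 oT Gc) ?inE// derive1_cst.
pose lam (s : R) :=
  ('[c^`(8) s, c s] + 2 * '[c^`(6) s, c s]
   + 3 * enorm (c^`(2) s) ^+ 2 - enorm (c^`(2) s) ^+ 4
   + 6 * enorm (c^`(2) s) ^+ 2 - 4
   + 2 * '[c^`(4) s, c^`(2) s])
  + (5 * '[c s, (fun u => '[c^`(4) u, c^`() u] *: c^`() u)^`(2) s]
     - '[c s, (fun u => enorm (c^`(2) u) ^+ 2 *: c u)^`(4) s]
     - 5 * '[c s, (fun u => '[c^`(4) u, c^`() u] *: c^`(2) u)^`() s]).
have q1 : (fun u : R => enorm (c^`(2) u) ^+ 2 *: c u) =
    (fun u => '[c^`(2) u, c^`(2) u] *: c u).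
  by apply/funext => u; rewrite enorm_sqr.
have q2 : (fun u : R => enorm (c^`(2) u) ^+ 2 : R) =
    (fun u => '[c^`(2) u, c^`(2) u]).
  by apply/funext => u; rewrite enorm_sqr.
(* The factor 2 is that of the t-derivative of <N, N>, which is twice the integrand of
   [exact_first_variation]. *)
have [] := exactZ 2 oJ (exact_first_variation lam oJ sc sz cc c11 cz z0 _).
  move=> s Js; exact: (eqn_norm_dot (eqn s (JI _ Js)) (enorm_sqr _)
    (congr1 (fun F => F^`(4) s) q1) (congr1 (fun F => F^`() s) q2)).
move=> B [sB Ba Bb FB].
pose N := iter 3 (nabla_dir G e2) ('D_e2 G).
have sN : vsmooth O N.
  by do 3!apply: vsmooth_nabla_dir => //; exact: vsmooth_derive.
have dE : is_derive (0 : R^o) 1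
    (fun t : R^o => \int[lebesgue_measure]_(s in `[a, b]) '[N (t, s), N (t, s)] : R^o) 0.
  have := is_derive_Rintegral J a b e (fun p => '[N p, N p]) e0 ab abJ
    (smooth_dot oO sN sN).
  suff -> : \int[lebesgue_measure]_(s in `[a, b]) 'D_e1 (fun p => '[N p, N p]) (0, s) = 0.
    by [].
  apply: etrans _ (Rintegral_derive1_eq0 J a b B ab abJ sB Ba Bb).
  apply: eq_Rintegral => s /set_mem /abJ Js.
  have sJ : s \in J by rewrite inE.
  rewrite -(FB s sJ) /=.
  have gE k : iter k (fun Y => 'D_e2 Y) G (0, s) = c^`(k) s.
    rewrite -(eq_on_derive1n k oJ cG _ sJ).
    by rewrite derive1n_second_slice.
  have zE k : iter k (fun Y => 'D_e2 Y) ('D_e1 G) (0, s) = z^`(k) s.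
    exact: (esym (congr1 (fun F => F s) (derive1n_second_slice k ('D_e1 G) 0))).
  exact: (derive_density_at e1 e2 (0, s) _ _ _ _ _ _ _ _ _ oO sG GG (O0 s Js)
    (gE 0%N) (gE 1%N) (gE 2%N) (gE 3%N) (gE 4%N)
    erefl (zE 1%N) (zE 2%N) (zE 4%N)
    (unit_speed_dots oJ sc cc c11 s Js) (c11 s Js)).
have -> : (fun t : R^o => energy 4 a b (fun s => G (t, s)) : R^o) =
    2^-1 \*: (fun t : R^o => \int[lebesgue_measure]_(s in `[a, b])
      '[N (t, s), N (t, s)] : R^o).
  by apply/funext => t; exact: energy4_slice.
by apply: is_derive_eq (is_deriveZ _ _) _; rewrite scaler0.
Qed.
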